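(* For every positive integer $\omega$ there is a circle graph with clique number at most $\omega$ and chromatic number at least $\omega(\ln \omega - 2)$.
   Context: A circle graph is the intersection graph of a finite set of chords of a circle: vertices correspond to chords and two vertices are adjacent when their chords intersect. *)

(* Defs.v *)
From mathcomp Require Import all_boot all_order all_algebra.
From mathcomp Require Import all_classical all_reals all_analysis.
Set Implicit Arguments.
Unset Strict Implicit.
Unset Printing Implicit Defensive.
Import Order.TTheory GRing.Theory Num.Theory.
Local Open Scope classical_set_scope.
Local Open Scope ring_scope.

Record sgraph := SGraph {
  vertex :> finType;
  adj : rel vertex;
  adj_sym : symmetric adj;
  adj_irrefl : irreflexive adj }.

Definition clique (G : sgraph) (K : {set G}) : bool :=
  [forall x in K, forall y in K, (x != y) ==> adj x y].

Definition clique_number (G : sgraph) : nat :=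
  \max_(K : {set G} | clique K) #|K|.

Definition proper_coloring (G : sgraph) (k : nat) (f : {ffun G -> 'I_k}) : bool :=
  [forall x, forall y, adj x y ==> (f x != f y)].

Definition colorable (G : sgraph) (k : nat) : bool :=
  [exists f : {ffun G -> 'I_k}, proper_coloring f].

Lemma colorable_exists (G : sgraph) : exists k, colorable G k.
Proof.
exists #|G|; apply/existsP; exists [ffun x => enum_rank x].
apply/forallP => x; apply/forallP => y; apply/implyP => xy.
rewrite !ffunE (inj_eq enum_rank_inj).
by apply: contraTneq xy => ->; rewrite adj_irrefl.
Qed.

Definition chromatic_number (G : sgraph) : nat := ex_minn (colorable_exists G).

Definition on_circle (R : realType) (c : R * R) (r : R) (p : R * R) : Prop :=
  (p.1 - c.1) ^+ 2 + (p.2 - c.2) ^+ 2 = r ^+ 2.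

Definition segment (R : realType) (p q : R * R) : set (R * R) :=
  [set ((1 - t) * p.1 + t * q.1, (1 - t) * p.2 + t * q.2) | t in `[0, 1]].

Definition is_chord (R : realType) (c : R * R) (r : R) (A : set (R * R)) : Prop :=
  exists p q, [/\ on_circle c r p, on_circle c r q, p <> q & A = segment p q].

(* Chords are closed segments, so two chords sharing an endpoint intersect.
   Injectivity of [ch] says that the vertices form a set, not a multiset, of
   chords. *)
Definition is_circle_graph (R : realType) (G : sgraph) : Prop :=
  exists (c : R * R) (r : R) (ch : G -> set (R * R)),
    [/\ 0 < r,
        injective ch,
        (forall u, is_chord c r (ch u)) &
        (forall u v, adj u v <-> u <> v /\ ch u `&` ch v !=set0)].

(* Main.v *)
(** Vertices are triples (a, b, j) with a < N, 0 < b - a < w and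
    j < w %/ (b - a + 1), where j numbers parallel copies of the interval
    [a, b].  Two vertices are adjacent when they are copies of one interval, or
    when their intervals overlap, a shared endpoint a' = b counting as overlap.

    A clique whose shortest interval has L integer points uses at most w %/ L
    copies of each interval and at most L intervals, hence has size at most w.
    An independent set is a laminar family of intervals, hence has size at
    most N + w.  With S the sum of w %/ m for 2 <= m <= w there are N * S
    vertices, so for N = S * w at least S >= w (ln w - 2) colours are needed. *)

Require Import Defs.
From mathcomp Require Import all_boot all_order all_algebra.
From mathcomp Require Import all_classical all_reals all_analysis.
From mathcomp Require Import zify ring lra.
Import Order.TTheory GRing.Theory Num.Theory.
Local Open Scope ring_scope.

Set Implicit Arguments.
Unset Strict Implicit.
Unset Printing Implicit Defensive.

(** * A lower bound for a harmonic sum of floors *)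

(** Each of the [w - 1] floors loses at most 1, and the harmonic sum from 1/2 to 1/[w] is at least
    [ln w - 1]. *)
Lemma ler_sum_divn_ln (R : realType) (w : nat) : (0 < w)%N ->
  w%:R * (ln w%:R - 2) <= (\sum_(k < w.-1) w %/ k.+2)%:R :> R.
Proof.
case: w => // v _ /=.
have lnH n : ln n.+1%:R <= \sum_(k < n) (k.+1%:R)^-1 :> R.
  elim: n => [|n IH]; first by rewrite ln1 big_ord0.
  have n1 : (0 : R) < n.+1%:R by rewrite ltr0n.
  have n1V : (0 : R) < n.+1%:R^-1 by rewrite invr_gt0.
  have -> : (n.+2%:R : R) = n.+1%:R * (1 + n.+1%:R^-1).
    by rewrite mulrDr mulr1 divff ?lt0r_neq0 // natr1.
  rewrite big_ord_recr /= lnM ?posrE ?addr_gt0 // lerD //.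
  by apply: le_ln1Dx; apply: lt_trans n1V; rewrite ltrN10.
have H1 : ln v.+1%:R - 1 <= \sum_(k < v) (k.+2%:R)^-1 :> R.
  have := lnH v.+1; rewrite big_ord_recl /= invr1 -lerBlDl.
  apply: le_trans; rewrite lerD2r ler_ln ?posrE ?ltr0n // ler_nat //.
have H2 : v.+1%:R * \sum_(k < v) (k.+2%:R)^-1 - v%:R
          <= (\sum_(k < v) v.+1 %/ k.+2)%:R :> R.
  rewrite natr_sum mulr_sumr -[X in _ - X%:R]card_ord -sumr_const -sumrB.
  apply: ler_sum => k _; rewrite lerBlDr natr1 ler_pdivrMr ?ltr0n // -natrM.
  by rewrite ler_nat ltnW // ltn_ceil.
apply: le_trans H2; rewrite -natr1.
have := ler_wpM2l (ler0n R v.+1) H1; rewrite -natr1.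
set s := \sum_(_ < _) _; set x := v%:R; set y := ln _; nra.
Qed.

(** * Sizes of independent sets, cliques and colour classes *)

Lemma card_laminar (T : finType) (A : {set T}) (a b : T -> nat) (n : nat) :
  {in A, forall x, (a x < b x <= n)%N} ->
  {in A &, forall x y, ~~ ((a x < a y <= b x) && (b x < b y))%N} ->
  {in A &, injective (fun x => (a x, b x))} -> (#|A| <= n)%N.
Proof.
move=> abn lam inj.
(* [c x] is the largest endpoint below [b x] of an interval starting at [a x]:
   laminarity makes it determine [x]. *)
pose m x := (\max_(y in A | (a y == a x) && (b y < b x)) b y)%N.
pose c x := maxn (a x) (m x).
have le_c x y : y \in A -> a y = a x -> (b y < b x)%N -> (b y <= c x)%N.
  move=> yA ay by_; rewrite leq_max; apply/orP; right.
  by apply: (@leq_bigmax_cond _ _ b y); rewrite yA ay eqxx.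
have c_ge x : (a x <= c x)%N by rewrite leq_maxl.
have c_lt x : x \in A -> (c x < b x)%N.
  move=> /abn/andP[ab _]; rewrite gtn_max ab /=.
  have b0 : (0 < b x)%N by lia.
  by rewrite -(prednK b0) ltnS; apply/bigmax_leqP => y; lia.
have c_attained x : (a x < c x)%N ->
    exists z, [/\ z \in A, a z = a x & b z = c x].
  move=> ac; have mc : m x = c x by rewrite /c; move: ac; rewrite /c; lia.
  case: (pickP [pred y in A | (a y == a x) && (b y < b x)%N]) => [y /= Py|P0].
    have [|z] := @eq_bigmax_cond _ [pred y in A | (a y == a x) && (b y < b x)%N] b.
      by apply/card_gt0P; exists y.
    move=> /= /and3P[zA /eqP az _] mE; exists z; split=> //.
    by rewrite -mc.
  (* An empty maximum is 0, which cannot exceed [a x]. *)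
  by move: mc ac; rewrite /m big_pred0 // => <-.
(* If [a x < a y], then [c x = c y] exceeds [a x], so it is the right end of some [z] in [A]
   starting at [a x]; this [z] overlaps [y]. *)
have c_inj_lt x y : x \in A -> y \in A -> c x = c y -> (a y <= a x)%N.
  move=> xA yA cxy; rewrite leqNgt; apply/negP => axy.
  have [|z [zA az bz]] := c_attained x; first by rewrite cxy (leq_trans axy).
  by move: (lam _ _ zA yA); rewrite az bz cxy axy c_ge c_lt.
have c_inj : {in A &, injective c}.
  move=> x y xA yA cxy.
  have axy : a x = a y by apply/eqP; rewrite eqn_leq !c_inj_lt.
  apply: inj => //; congr pair => //; apply/eqP; rewrite eqn_leq.
  apply/andP; split; rewrite leqNgt; apply/negP => blt.
  - by have := le_c x y yA (esym axy) blt; rewrite cxy leqNgt c_lt.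
  - by have := le_c y x xA axy blt; rewrite -cxy leqNgt c_lt.
(* [inord] needs a non-empty ordinal type, so [n = 0], where [A] is empty, is treated apart. *)
case: n abn => [|n] abn.
  by rewrite leqn0 cards_eq0; apply/eqP/setP => x; rewrite inE; apply/negP => /abn; lia.
have c_n x : x \in A -> (c x < n.+1)%N.
  by move=> xA; apply: leq_trans (c_lt _ xA) _; case/andP: (abn _ xA).
rewrite -[n.+1]card_ord -(@card_in_imset _ 'I_n.+1 (fun x => inord (c x))) ?max_card //.
move=> x y xA yA /(congr1 val) /=; by rewrite !inordK ?c_n //; exact: c_inj.
Qed.

Definition overlap_adj (V : Type) (a b j : V -> nat) (x y : V) : bool :=
  [|| [&& a x == a y, b x == b y & j x != j y],
      ((a x < a y <= b x) && (b x < b y))%N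
    | ((a y < a x <= b y) && (b y < b x))%N].

Lemma card_overlap_clique (T : finType) (K : {set T}) (a b j : T -> nat) (w : nat) :
  {in K, forall x, (j x < w %/ (b x - a x).+1)%N} ->
  {in K, forall x, (a x <= b x)%N} ->
  {in K &, forall x y, x != y -> overlap_adj a b j x y} ->
  (#|K| <= w)%N.
Proof.
move=> jw ab cl.
have [->|[x0 x0K]] := set_0Vmem K; first by rewrite cards0.
case: (arg_minnP (fun x => b x - a x)%N x0K) => x xK minx.
set L := (b x - a x).+1.
(* [x] is a shortest interval: the clique member [y] has an endpoint inside
   [x], or just after it, and [p y] is its position. *)
pose p y := (if a y < a x then (b y).+1 - a x else a y - a x)%N.
have clP y : y \in K -> y = x \/ overlap_adj a b j x y.
  by move=> yK; have [->|yx] := eqVneq y x; [left|right; rewrite cl // eq_sym].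
have pL y : y \in K -> (p y < L)%N.
  move=> yK; have := ab _ xK; have := ab _ yK; rewrite /p /L.
  by case: (clP _ yK) => [->|]; rewrite /overlap_adj; case: ifP; lia.
have jL y : y \in K -> (j y < w %/ L)%N.
  by move=> yK; apply: leq_trans (jw _ yK) _; rewrite leq_div2l // ltnS minx.
(* If [y] and [z] meet [x] from the same side, equal positions give a common left or a common right
   end, so adjacency forces copies with different [j]. From opposite sides, the successor in [p]
   makes one interval end just before the other starts, so they are not adjacent. *)
have inj : {in K &, injective (fun y => (p y, j y))}.
  move=> y z yK zK [pyz jyz]; apply/eqP/negPn/negP => yz; move: pyz jyz (yz).
  have := cl _ _ yK zK yz; have := ab _ xK; have := ab _ yK; have := ab _ zK.
  by rewrite /p; case: (clP _ yK) (clP _ zK) => [->|+] [->|]; rewrite /overlap_adj ?eqxx //;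
    do ?case: ifP; lia.
have wL : (0 < w %/ L)%N by apply: leq_ltn_trans (jL _ xK).
apply: leq_trans (leq_divM w L); rewrite mulnC.
rewrite -(prednK wL) -[X in (X * _)%N]card_ord -[X in (_ * X)%N]card_ord -card_prod.
rewrite -(@card_in_imset _ _ (fun y => (inord (p y) : 'I_L, inord (j y) : 'I_(w %/ L).-1.+1))) ?max_card //.
move=> y z yK zK [/(congr1 val) /= py /(congr1 val) /= jy]; apply: inj => //.
by move: py jy; rewrite !inordK ?prednK ?pL ?jL // => -> ->.
Qed.

Lemma chromatic_number_lower_bound (G : sgraph) (n : nat) :
  (forall A : {set G}, {in A &, forall x y, ~~ adj x y} -> (#|A| <= n)%N) ->
  (#|G| <= chromatic_number G * n)%N.
Proof.
move=> indep; rewrite /chromatic_number; case: ex_minnP => k /existsP[f fP] _.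
rewrite -sum1_card (partition_big f predT) //=.
rewrite -[k in (k * n)%N]card_ord -sum_nat_const.
apply: leq_sum => i _; rewrite sum1dep_card; apply: indep => x y.
rewrite !inE => /eqP fx /eqP fy; apply/negP => xy.
by move/forallP/(_ x)/forallP/(_ y): fP; rewrite xy fx fy eqxx.
Qed.

(** * Chords of the unit circle and overlapping real intervals *)

Local Open Scope classical_set_scope.

(* The rational parametrisation, by the tangent of the half angle. *)
Definition circle_point (R : realType) (t : R) : R * R :=
  ((1 - t ^+ 2) / (1 + t ^+ 2), 2 * t / (1 + t ^+ 2)).

(* An affine form vanishing at the circle points of parameters [s] and [t];
   see [secant_circle_point] for its values on the circle. *)
Definition secant (R : realType) (s t : R) (p : R * R) : R :=
  ((1 - p.1) - (s + t) * p.2 + s * t * (1 + p.1)) / 2.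

Lemma sqr1D_gt0 (R : realType) (t : R) : 0 < 1 + t ^+ 2.
Proof. by rewrite ltr_wpDr ?sqr_ge0. Qed.

Lemma circle_pointP (R : realType) (t : R) : on_circle (0, 0) 1 (circle_point t).
Proof.
have t0 := lt0r_neq0 (sqr1D_gt0 t).
by rewrite /on_circle /=; field.
Qed.

Lemma secant_circle_point (R : realType) (s t u : R) :
  secant s t (circle_point u) = (u - s) * (u - t) / (1 + u ^+ 2).
Proof.
have t0 := lt0r_neq0 (sqr1D_gt0 u).
by rewrite /secant /=; field.
Qed.

Lemma secant_segment (R : realType) (s t c : R) (p q : R * R) :
  secant s t ((1 - c) * p.1 + c * q.1, (1 - c) * p.2 + c * q.2) =
  (1 - c) * secant s t p + c * secant s t q.
Proof. by rewrite /secant /=; field. Qed.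

Lemma secant_chord (R : realType) (s t : R) (p : R * R) :
  segment (circle_point s) (circle_point t) p -> secant s t p = 0.
Proof.
case=> c _ <-; rewrite secant_segment !secant_circle_point.
by rewrite !subrr !(mulr0, mul0r) addr0.
Qed.

(** Both ends of the second chord lie on the positive side of the line through the first, and the
    affine form [secant] stays positive between them. *)
Lemma chords_disjoint (R : realType) (s s' t t' : R) :
  0 < (t - s) * (t - s') -> 0 < (t' - s) * (t' - s') ->
  ~ (segment (circle_point s) (circle_point s')
     `&` segment (circle_point t) (circle_point t') !=set0).
Proof.
move=> h h' [p [/secant_chord sp [c c01 pE]]]; move: sp c01.
rewrite -pE secant_segment /= in_itv /= => + /andP[c0 c1].
rewrite !secant_circle_point.
have := divr_gt0 h (sqr1D_gt0 t); have := divr_gt0 h' (sqr1D_gt0 t').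
set x := _ / _; set y := _ / _; nra.
Qed.

Lemma chords_cross (R : realType) (s s' t t' : R) :
  s < t -> t < s' -> s' < t' ->
  segment (circle_point s) (circle_point s')
    `&` segment (circle_point t) (circle_point t') !=set0.
Proof.
move=> st ts' st'.
(* The intersection point is the barycentre of the ends of either chord, with
   weights [al], [al'] and [be], [be']. *)
pose al := (1 + s ^+ 2) * ((s' - t) * (t' - s') * (t' - t)).
pose al' := (1 + s' ^+ 2) * ((t - s) * (t' - s) * (t' - t)).
pose be := (1 + t ^+ 2) * ((s' - s) * (t' - s') * (t' - s)).
pose be' := (1 + t' ^+ 2) * ((t - s) * (s' - s) * (s' - t)).
have [al0 al'0 be0 be'0] : [/\ 0 < al, 0 < al', 0 < be & 0 < be'].
  by split; rewrite !mulr_gt0 ?sqr1D_gt0 ?subr_gt0 //; lra.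
(* Each weight is, up to sign and cleared denominators, the other chord's [secant] at the opposite
   end; the factors [t' - t] and [s' - s] make the totals agree. *)
have e : al + al' = be + be' by rewrite /al /al' /be /be'; ring.
have frac (x y : R) : 0 < x -> 0 < y -> 0 <= y / (x + y) <= 1.
  move=> x0 y0; have xy : 0 < x + y by rewrite addr_gt0.
  rewrite divr_ge0 ?ler_pdivrMr //; lra.
have n0 : al + al' != 0 by apply: lt0r_neq0; lra.
have n0' : be + be' != 0 by rewrite -e.
have s0 := lt0r_neq0 (sqr1D_gt0 s).
have s0' := lt0r_neq0 (sqr1D_gt0 s').
have t0 := lt0r_neq0 (sqr1D_gt0 t).
have t0' := lt0r_neq0 (sqr1D_gt0 t').
pose p x y (u v : R * R) := ((1 - y / (x + y)) * u.1 + y / (x + y) * v.1,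
   (1 - y / (x + y)) * u.2 + y / (x + y) * v.2).
have pE x y u v : x + y != 0 ->
   p x y u v = ((x * u.1 + y * v.1) / (x + y), (x * u.2 + y * v.2) / (x + y)).
  by move=> xy; rewrite /p; congr pair; field.
exists (p al al' (circle_point s) (circle_point s')); split.
  by exists (al' / (al + al')) => //; rewrite /= in_itv; exact: frac.
exists (be' / (be + be')); first by rewrite /= in_itv; exact: frac.
rewrite -/(p be be' (circle_point t) (circle_point t')) !pE // e.
by congr pair; congr (_ / _); rewrite /al /al' /be /be' /=; field; rewrite ?s0 ?s0' ?t0 ?t0'.
Qed.

(** Under [circle_point], overlap means that the ends of the two chords alternate; otherwise the
    intervals are disjoint or nested. *)
Lemma overlap_circle_graph (R : realType) (G : sgraph) (l r : G -> R) :
  (forall u, l u < r u) ->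
  (forall u v, u != v -> [&& l u != l v, r u != r v & l u != r v]) ->
  (forall u v, adj u v = (l u < l v < r u) && (r u < r v)
                      || (l v < l u < r v) && (r v < r u)) ->
  is_circle_graph R G.
Proof.
move=> lr neq adjE.
exists (0, 0), 1, (fun u => segment (circle_point (l u)) (circle_point (r u))).
(* The end of the chord of [u] at [l u] lies on no other chord, which separates the chords as
   sets. *)
have meet u : exists p, segment (circle_point (l u)) (circle_point (r u)) p /\
    forall v, u != v -> ~ segment (circle_point (l v)) (circle_point (r v)) p.
  exists (circle_point (l u)); split.
    exists 0; first by rewrite /= in_itv /= lexx ler01.
    by rewrite subr0 !mul1r !mul0r !addr0; case: circle_point.
  move=> v /neq /and3P[ll _ lr'] /secant_chord/eqP.
  by rewrite secant_circle_point !mulf_eq0 !subr_eq0 invr_eq0 (negPf ll) (negPf lr')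
             (negPf (lt0r_neq0 (sqr1D_gt0 _))).
split=> //.
- move=> u v /= E; apply/eqP/negP => /negP uv.
  by have [p [pu /(_ v uv)]] := meet u; rewrite -E.
- move=> u; exists (circle_point (l u)), (circle_point (r u)).
  split=> //; try exact: circle_pointP.
  move=> /(congr1 (secant (l u) (l u))); rewrite !secant_circle_point.
  rewrite subrr mul0r mul0r => /esym/eqP.
  rewrite !mulf_eq0 !subr_eq0 invr_eq0 (negPf (lt0r_neq0 (sqr1D_gt0 _))).
  by rewrite !gt_eqF.
- move=> u v; rewrite adjE; split.
    move=> /orP uv; split.
      by move=> E; move: uv; rewrite E ltxx /= => -[].
    case: uv => /andP[/andP[? ?] ?]; first exact: chords_cross.
    by rewrite setIC; exact: chords_cross.
  move=> [/eqP uv I]; move: (neq _ _ uv) => /and3P[ll rr lr'].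
  have /neq/and3P[_ _ rl'] : v != u by rewrite eq_sym.
  have lru := lr u; have lrv := lr v.
  case: I => p Ip; case: (ltgtP (l u) (l v)) ll rr lr' rl' => // h1 _;
  case: (ltgtP (r u) (r v)) => // h2 _; case: (ltgtP (l u) (r v)) => // h3 _;
  case: (ltgtP (l v) (r u)) => // h4 _ /=.
  all: try by exfalso; lra.
  all: exfalso.
  all: have pos (x y : R) : 0 < x /\ 0 < y \/ x < 0 /\ y < 0 -> 0 < x * y
    by case=> -[x0 y0]; [exact: mulr_gt0 | rewrite nmulr_rgt0].
  (* Of two nested intervals only the outer one has its ends outside the other, hence both roles are
     tried. *)
  all: first [ by apply: (@chords_disjoint R (l u) (r u) (l v) (r v)); last (by exists p);
               apply: pos; first [by left; split; lra | by right; split; lra]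
             | by apply: (@chords_disjoint R (l v) (r v) (l u) (r u));
               last (by rewrite setIC; exists p);
               apply: pos; first [by left; split; lra | by right; split; lra] ].
Qed.

(** * Making shared endpoints distinct by a lexicographic encoding *)

Lemma ltn_lex (C x y i j : nat) : (i < C)%N -> (j < C)%N ->
  (x * C + i < y * C + j)%N = (x < y)%N || (x == y) && (i < j)%N.
Proof.
move=> iC jC; case: (ltngtP x y) => [xy|yx|->] /=; last by rewrite ltn_add2l.
- by have := leq_mul xy (leqnn C); lia.
- by have := leq_mul yx (leqnn C); lia.
Qed.

Lemma eqn_lex (C x y i j : nat) : (i < C)%N -> (j < C)%N ->
  (x * C + i == y * C + j)%N = (x == y) && (i == j).
Proof.
move=> iC jC; case: (ltngtP x y) => [xy|yx|->] /=; last by rewrite eqn_add2l.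
- by rewrite ltn_eqF // ltn_lex // xy.
- by rewrite gtn_eqF // ltn_lex // yx.
Qed.

Lemma overlap_adj_circle_graph (R : realType) (G : sgraph) (a b j : G -> nat)
    (C : nat) :
  (forall x, a x < b x)%N -> (forall x, maxn (b x) (j x) < C)%N ->
  injective (fun x => (a x, b x, j x)) ->
  adj (s := G) =2 overlap_adj a b j -> is_circle_graph R G.
Proof.
move=> ab bjC inj adjE.
(* At a common integer point, left endpoints are put before right endpoints,
   and longer intervals outside shorter ones; copies of one interval are
   shifted by [j] so as to overlap. *)
pose l x := ((2 * a x * C + (C - (b x).+1)) * C + j x)%N.
pose r x := (((2 * b x).+1 * C + (C - (a x).+1)) * C + j x)%N.
have bC' x : (b x < C)%N by have := bjC x; lia.
have jC x : (j x < C)%N by have := bjC x; lia.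
have aC x : (C - (a x).+1 < C)%N by have := bjC x; have := ab x; lia.
have bC x : (C - (b x).+1 < C)%N by have := bjC x; lia.
have subE x y : (x < C)%N -> (y < C)%N ->
    ((C - x.+1 < C - y.+1)%N = (y < x)%N) * ((C - x.+1 == C - y.+1)%N = (x == y)).
  by move=> xC yC; split; lia.
have dblE x y : ((2 * x < 2 * y) = (x < y))%N * ((2 * x == 2 * y)%N = (x == y))
    * (((2 * x).+1 < (2 * y).+1) = (x < y))%N * (((2 * x).+1 == (2 * y).+1) = (x == y))
    * ((2 * x < (2 * y).+1) = (x <= y))%N * (((2 * x).+1 < 2 * y) = (x < y))%N
    * ((2 * x == (2 * y).+1)%N = false) * (((2 * x).+1 == 2 * y)%N = false).
  by do !split; lia.
have aC' x : (a x < C)%N by apply: ltn_trans (bC' x).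
have lexE := (ltn_lex, eqn_lex, subE, dblE).
apply: (@overlap_circle_graph R G (fun x => (l x)%:R) (fun x => (r x)%:R)).
- move=> u; rewrite ltr_nat /l /r !lexE //.
  by have := ab u; lia.
- move=> u v; rewrite !eqr_nat /l /r !lexE //.
  apply: contra_neqT => uv; apply: inj.
  have [-> [-> ->]] : a u = a v /\ b u = b v /\ j u = j v by lia.
  by [].
- move=> u v; rewrite adjE !ltr_nat /l /r !lexE // /overlap_adj.
  have := ab u; have := ab v.
  case: (ltngtP (a u) (a v)) => // [||->]; case: (ltngtP (b u) (b v)) => // [||->];
    by rewrite /= ?andbF ?andbT ?orbF //=; lia.
Qed.

(** * Choice of parameters and count of vertices *)

Theorem theorem2 (R : realType) (w : nat) (hw : (0 < w)%N) :
  exists G : sgraph,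
    [/\ is_circle_graph R G,
        (clique_number G <= w)%N &
        w%:R * (ln w%:R - 2) <= (chromatic_number G)%:R :> R].
Proof.
pose S := (\sum_(k < w.-1) w %/ k.+2)%N.
pose N := (S * w)%N.
(* The middle component is [b - a - 1], so the interval has that number plus 2 integer points. *)
pose V := {x : 'I_N * 'I_w.-1 * 'I_w | x.2 < w %/ x.1.2.+2}%N.
pose a (x : V) : nat := (val x).1.1.
pose b (x : V) : nat := (a x + (val x).1.2).+1.
pose j (x : V) : nat := (val x).2.
have sym : symmetric (overlap_adj a b j).
  move=> x y; rewrite /overlap_adj (eq_sym (a x)) (eq_sym (b x)) (eq_sym (j x)).
  by congr (_ || _); rewrite orbC.
have irr : irreflexive (overlap_adj a b j).
  by move=> x; rewrite /overlap_adj !ltnn !eqxx.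
have ab x : (a x < b x)%N by rewrite ltnS leq_addr.
have aN x : (a x < N)%N by apply: ltn_ord.
have bw x : (b x < a x + w)%N by rewrite /b; have := ltn_ord (val x).1.2; lia.
have abj : injective (fun x => (a x, b x, j x)).
  move=> x y [axy bxy jxy]; apply: val_inj.
  move: axy bxy jxy; rewrite /b /a /j /=.
  case: (sval x) (sval y) => [[? ?] ?] [[? ?] ?] /= axy bxy jxy.
  congr (_, _, _); apply: val_inj => //=; lia.
have jw x : (j x < w %/ (b x - a x).+1)%N.
  rewrite /b subSn ?leq_addr // addKn; exact: (valP x).
pose G := SGraph sym irr.
have cardG : #|G| = (N * S)%N.
  rewrite card_sig -sum1_card.
  rewrite (eq_bigl (fun x : 'I_N * 'I_w.-1 * 'I_w => true && (x.2 < w %/ x.1.2.+2)%N)) //.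
  rewrite -(pair_big_dep predT
    (fun (p : 'I_N * 'I_w.-1) (i : 'I_w) => i < w %/ p.2.+2)%N (fun _ _ => 1%N)) /=.
  rewrite -(pair_big_dep predT (fun _ => predT)
    (fun (_ : 'I_N) (k : 'I_w.-1) => \sum_(i < w | (i < w %/ k.+2)%N) 1)%N) /=.
  rewrite sum_nat_const card_ord; congr (_ * _)%N; apply: eq_bigr => k _.
  by rewrite -(big_ord_widen w (fun=> 1%N)) ?leq_div // sum1_card card_ord.
exists G; split.
- apply: (@overlap_adj_circle_graph R G a b j (N + w)) => // x.
  by have := bw x; have := aN x; have := ltn_ord (val x).2; rewrite -/(j x); lia.
- apply/bigmax_leqP => K /forall_inP cl; apply: (@card_overlap_clique _ K a b j).
  + by move=> x _.
  + by move=> x _; apply: ltnW.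
  + by move=> x y xK yK xy; move/forall_inP/(_ y yK)/implyP: (cl x xK); apply.
apply: le_trans (ler_sum_divn_ln R hw) _; rewrite ler_nat -/S.
have : (#|G| <= chromatic_number G * (N + w))%N.
  apply: chromatic_number_lower_bound => A indep.
  apply: (@card_laminar _ A a b).
  + by move=> x _; rewrite ab; have := bw x; have := aN x; lia.
  + move=> x y xA yA; move: (indep x y xA yA); rewrite /= /overlap_adj; lia.
  (* Copies of one interval are adjacent, so an independent set holds at most one of them. *)
  + move=> x y xA yA E; have axy : a x = a y := congr1 fst E.
    have bxy : b x = b y := congr1 snd E.
    have jxy : j x = j y.
      by move: (indep x y xA yA); rewrite /= /overlap_adj axy bxy; lia.
    by apply: abj; rewrite axy bxy jxy.
(* Dividing by [w] gives [S ^ 2 <= chi * (S + 1)] for the chromatic number [chi], whereas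
   [chi <= S - 1] would bound the right side by [S ^ 2 - 1]. *)
rewrite cardG /N => h; rewrite leqNgt; apply/negP => chi; nia.
Qed.
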